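(* Let $\mathcal{C}=\{C:\mathbb{F}_2^{k}\to\mathbb{F}_2^{n}\}$ be an infinite family of $[n,k(n),d(n)]$ binary linear codes (with $n\to\infty$ along the family) satisfying $k(n)\,d(n)=\omega(n)$. Suppose there is a constant $\ell$, independent of $n$, such that for every code $C:\mathbb{F}_2^k\to\mathbb{F}_2^n$ in the family and every $i\in[k]$ there exist $j\in[k]$ with $j\neq i$, and a gadget $\overline{G}_i$ (a circuit acting on the $n$ code bits) such that: (1) $\overline{G}_i$ encodes the gate $G_i=\mathrm{CNOT}_{i,j}$, i.e. $\overline{G}_i\circ C=C\circ G_i$; (2) $\overline{G}_i$ has depth $\ell$. Then $$k=O\!\left(\frac{n}{d^{1/q}}\right),$$ where $1<q\le 2^{\ell}$ is a constant.
   Context: $[k]=\{1,\dots,k\}$. A binary linear $[n,k,d]$ code is an (injective) linear encoding map $C:\mathbb{F}_2^k\to\mathbb{F}_2^n$, where $d$ is the minimum Hamming weight of a nonzero element of the image. The code comes with the privileged basis $g_1,\dots,g_k$ of its image, $g_i=C(e_i)$ with $e_i$ the standard basis vectors of $\mathbb{F}_2^k$. In a code family, $k=k(n)$ and $d=d(n)$ are regarded as functions of the block length $n$, and asymptotic notation refers to $n\to\infty$ along the family. For distinct $i,j\in[k]$, $\mathrm{CNOT}_{i,j}:\mathbb{F}_2^k\to\mathbb{F}_2^k$ is the map $m\mapsto m+m_i e_j$. Circuit model: a circuit acts on a set of bit registers and is composed of gates with fan-in and fan-out at most $2$ (each gate acts on one or two registers, and need not be linear or reversible). In each time step each register participates in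 at most one gate. The depth is the number of time steps. A gadget for an operation $G:\mathbb{F}_2^k\to\mathbb{F}_2^k$ is a circuit $\overline{G}:\mathbb{F}_2^n\to\mathbb{F}_2^n$ on the $n$ registers holding the codeword, possibly using $O(n)$ ancillary scratch bits, with $\overline{G}\circ C=C\circ G$; its output is held in the same $n$ registers. *)

(* Defs.v *)
From HB Require Import structures.
From mathcomp Require Import all_boot all_order all_algebra.

Set Implicit Arguments.
Unset Strict Implicit.
Unset Printing Implicit Defensive.

Import GRing.Theory.
Local Open Scope ring_scope.

Definition hweight (n : nat) (c : 'rV['F_2]_n) : nat :=
  #|[set v | c 0 v != 0]|.

(* The linearity of the encoding map is carried by its type. Since the minimum
   weight d has to be attained by some nonzero codeword, this implies k > 0. *)
Definition is_code (n k d : nat)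
    (C : {linear 'rV['F_2]_k -> 'rV['F_2]_n}) : Prop :=
  [/\ injective C,
      exists2 m, C m != 0 & hweight (C m) = d
    & forall m, C m != 0 -> (d <= hweight (C m))%N].

Definition CNOT (k : nat) (i j : 'I_k) (m : 'rV['F_2]_k) : 'rV['F_2]_k :=
  m + m 0 i *: delta_mx 0 j.

(* A gate reads and overwrites the one or two registers it acts on, by an
   arbitrary (possibly nonlinear or irreversible) function. *)
Inductive gate (N : nat) : Type :=
| Gate1 (u : 'I_N) (f : 'F_2 -> 'F_2)
| Gate2 (u v : 'I_N) (f : 'F_2 -> 'F_2 -> 'F_2 * 'F_2).

Definition gate_regs (N : nat) (g : gate N) : seq 'I_N :=
  match g with
  | Gate1 u _ => [:: u]
  | Gate2 u v _ => [:: u; v]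
  end.

Definition run_gate (N : nat) (s : 'rV['F_2]_N) (g : gate N) : 'rV['F_2]_N :=
  match g with
  | Gate1 u f => \row_w (if w == u then f (s 0 u) else s 0 w)
  | Gate2 u v f =>
      \row_w (if w == u then (f (s 0 u) (s 0 v)).1
              else if w == v then (f (s 0 u) (s 0 v)).2
              else s 0 w)
  end.

(* One time step. By the uniqueness condition the two registers of a Gate2 are
   distinct and distinct gates act on disjoint registers, so the order in which
   the gates of a time step are run is irrelevant. *)
Record layer (N : nat) : Type := Layer {
  layer_gates :> seq (gate N);
  layer_uniq : uniq (flatten [seq gate_regs g | g <- layer_gates])
}.

Definition run_layer (N : nat) (s : 'rV['F_2]_N) (L : layer N) :
    'rV['F_2]_N :=
  foldl (@run_gate N) s L.

Definition circuit (N : nat) : Type := seq (layer N).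

Definition depth (N : nat) (c : circuit N) : nat := size c.

Definition run_circuit (N : nat) (c : circuit N) (s : 'rV['F_2]_N) :
    'rV['F_2]_N :=
  foldl (@run_layer N) s c.

(* The map induced on the n code registers by a circuit on n code registers
   followed by a scratch registers, the latter initialised to zero and
   discarded at the end. *)
Definition gadget_map (n a : nat) (c : circuit (n + a)) (x : 'rV['F_2]_n) :
    'rV['F_2]_n :=
  lsubmx (run_circuit c (row_mx x 0)).

Definition is_gadget (n k a : nat) (C : 'rV['F_2]_k -> 'rV['F_2]_n)
    (G : 'rV['F_2]_k -> 'rV['F_2]_k) (c : circuit (n + a)) : Prop :=
  gadget_map c \o C =1 C \o G.

(* Main.v *)
(* A circuit of depth l has light cones of size at most 2^l in both directions.
   If it implements CNOT_{i,j}, then for every v in the support of g_j the bits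
   of the codeword in the backward cone of v determine m_i, so the at least d
   such cones contain at least d / 4^l pairwise disjoint sets of at most
   q = 2^l coordinates, each of which determines m_i.  As in the Katz-Trevisan
   bound for locally decodable codes, colour the coordinates at random with s
   colours, where s^q is at most the number of these sets: with probability at
   least 1/2 one of them is monochromatic of a given colour.  A set of
   coordinates determines at most as many message bits as it has elements, so
   that averaging gives k s / 2 <= n.  If l = 0 then the gadgets are trivial, which is impossible. *)
Require Import Defs.
From HB Require Import structures.
From mathcomp Require Import all_boot all_order all_algebra all_fingroup zify.
Set Implicit Arguments.
Unset Strict Implicit.
Unset Printing Implicit Defensive.
Import Order.TTheory GRing.Theory Num.Theory.
Local Open Scope ring_scope.

(** * Light cones of a circuit *)

(* [p] swaps the two registers of each [Gate2]; being a permutation, it bounds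
   the fan-out of a layer as well as its fan-in. *)
Lemma run_gates_local (N : nat) (gs : seq (gate N)) :
  uniq (flatten [seq gate_regs g | g <- gs]) ->
  exists p : {perm 'I_N},
    (forall w, w \notin flatten [seq gate_regs g | g <- gs] -> p w = w) /\
    forall (s s' : 'rV['F_2]_N) w, s 0 w = s' 0 w -> s 0 (p w) = s' 0 (p w) ->
      foldl (@run_gate N) s gs 0 w = foldl (@run_gate N) s' gs 0 w.
Proof.
elim: gs => [_|g gs IH] /=.
  by exists 1%g; split=> [w _|s s' w]; rewrite ?perm1.
rewrite cat_uniq => /and3P[ug /hasPn gP /IH[p [pfix ploc]]].
have pg w : w \in gate_regs g -> p w = w.
  by move=> wg; apply: pfix; apply/negP => /gP; rewrite /= wg.
case: g ug gP pg => [u f|u v f] /= ug gP pg.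
  exists p; split=> [w|s s' w sw spw].
    by rewrite inE negb_or => /andP[_]; exact: pfix.
  apply: ploc; rewrite !mxE; first by case: eqP => [<-|]; rewrite ?sw.
  by case: eqP => [<-|]; rewrite ?spw.
have pu : p u = u by apply: pg; rewrite mem_head.
have pv : p v = v by apply: pg; rewrite !inE eqxx orbT.
(* The later gates avoid [u] and [v], so [p] fixes both; the product exchanges them and agrees with
   [p] elsewhere. *)
exists (tperm u v * p)%g; split=> [w|s s' w sw].
  rewrite !inE !negb_or => /and3P[wu wv wgs].
  by rewrite permM tpermD ?pfix // eq_sym.
rewrite permM; case: tpermP => [wu|wv|/eqP wu /eqP wv] spw.
- by apply: ploc; rewrite wu ?pu !mxE eqxx; move: sw spw; rewrite wu pv => -> ->.
- apply: ploc; rewrite wv ?pv !mxE eqxx; move: sw spw; rewrite wv pu => -> ->;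
    by case: eqP => // ->.
- apply: ploc; rewrite !mxE; first by rewrite (negPf wu) (negPf wv).
  have -> : (p w == u) = false by rewrite -pu (inj_eq perm_inj) (negPf wu).
  have -> // : (p w == v) = false by rewrite -pv (inj_eq perm_inj) (negPf wv).
Qed.

(** Peel off the first layer: a register [u] in the cone of the remaining circuit depends only on
    [u] and [p u] before that layer. So each layer at most doubles the cones, and injectivity of [p]
    gives the same for forward cones. *)
Lemma run_circuit_local (N : nat) (c : circuit N) :
  exists cone : 'I_N -> {set 'I_N},
    [/\ forall v, v \in cone v,
        forall v, (#|cone v| <= 2 ^ depth c)%N,
        forall u, (#|[set v | u \in cone v]| <= 2 ^ depth c)%N &
        forall (s s' : 'rV['F_2]_N) v,
          (forall u, u \in cone v -> s 0 u = s' 0 u) ->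
          run_circuit c s 0 v = run_circuit c s' 0 v].
Proof.
elim: c => [|L c [cone [cone_refl card_cone card_fcone coneP]]].
  exists set1; split=> [v|v|u|s s' v] //=; rewrite ?set11 ?cards1 //.
    rewrite (_ : [set v | _] = [set u]) ?cards1 //.
    by apply/setP => v; rewrite !inE eq_sym.
  by apply; rewrite set11.
have [p [_ ploc]] := run_gates_local (layer_uniq L).
exists (fun v => cone v :|: p @: cone v); split=> [v|v|u|s s' v ss'] /=.
- by rewrite inE cone_refl.
- rewrite expnS mul2n -addnn (leq_trans (leq_card_setU _ _)) // leq_add //.
  exact: leq_trans (leq_imset_card _ _) _.
- rewrite expnS mul2n -addnn.
  apply: leq_trans (leq_add (card_fcone u) (card_fcone ((p^-1)%g u))).
  apply: leq_trans (leq_card_setU _ _); apply: subset_leq_card.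
  apply/subsetP => v; rewrite !inE => /orP[->//|/imsetP[w wv ->]].
  by rewrite permK wv orbT.
- apply: coneP => u uv; apply: ploc; apply: ss'; rewrite inE ?uv //.
  by rewrite imset_f ?orbT.
Qed.

(** * Recovery sets from a CNOT gadget *)

(* As C is linear, this says that the bits of C m in S determine m_i. *)
Definition recovers (n k : nat) (C : 'rV['F_2]_k -> 'rV['F_2]_n)
    (i : 'I_k) (S : {set 'I_n}) : Prop :=
  forall m, (forall u, u \in S -> C m 0 u = 0) -> m 0 i = 0.

(** If [C m] vanishes on the cone of [v], the gadget outputs at [v] the same bit as on the zero
    codeword, namely 0. That bit is also [C m] at [v], which is 0 since [v] lies in its own cone,
    plus m_i times g_j at [v]. *)
Lemma CNOT_gadget_recovers (n k a : nat)
    (C : {linear 'rV['F_2]_k -> 'rV['F_2]_n}) (i j : 'I_k)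
    (c : circuit (n + a)) :
  is_gadget C (CNOT i j) c ->
  exists S : 'I_n -> {set 'I_n},
    [/\ forall v, v \in S v,
        forall v, (#|S v| <= 2 ^ depth c)%N,
        forall u, (#|[set v | u \in S v]| <= 2 ^ depth c)%N &
        forall v, C (delta_mx 0 j) 0 v != 0 -> recovers C i (S v)].
Proof.
move=> gadC; have [cone [cone_refl card_cone card_fcone coneP]] := run_circuit_local c.
have inj_l : injective (@lshift n a) := @lshift_inj n a.
(* Scratch registers start at zero for every input, so only the code registers of a cone matter. *)
exists (fun v => lshift a @^-1: cone (lshift a v)); split=> [v|v|u|v gv m m0].
- by rewrite inE.
- rewrite -(card_imset _ inj_l); apply: leq_trans (card_cone (lshift a v)).
  by apply/subset_leq_card/subsetP => _ /imsetP[u uS ->]; move: uS; rewrite inE.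
- rewrite -(card_imset _ inj_l); apply: leq_trans (card_fcone (lshift a u)).
  by apply/subset_leq_card/subsetP => _ /imsetP[w wS ->]; move: wS; rewrite !inE.
- have: gadget_map c (C m) 0 v = gadget_map c (C 0) 0 v.
    rewrite !mxE; apply: coneP => u; rewrite linear0.
    case: (split_ordP u) => u' -> uv; rewrite ?row_mxEl ?row_mxEr //.
    by rewrite m0 ?inE // mxE.
  have := gadC m; have := gadC 0; rewrite /= => -> ->.
  have Cm0 : C m 0 v = 0 by apply: m0; rewrite inE.
  rewrite /CNOT linearD linearZ mxE Cm0 add0r mxE.
  rewrite [in RHS]mxE scale0r addr0 linear0 mxE => /eqP.
  by rewrite mulf_eq0 (negPf gv) orbF => /eqP.
Qed.

(** * Extracting disjoint sets *)

(** For a maximal [B], the chosen sets cover at most [q * #|S @: B|] points; every [S v] with [v] in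
    [A] contains such a point, and each point lies in [S v] for at most [r] values of [v]. *)
Lemma disjoint_subfamily (T : finType) (S : T -> {set T}) (q r : nat)
    (A : {set T}) :
  (forall v, v \in S v) -> (forall v, #|S v| <= q)%N ->
  (forall u, #|[set v | u \in S v]| <= r)%N ->
  exists2 B : {set T}, B \subset A /\ trivIset (S @: B) &
    (#|A| <= r * (q * #|S @: B|))%N.
Proof.
move=> Srefl Sq Sr.
pose P (B : {set T}) := (B \subset A) && trivIset (S @: B).
have P0 : P set0 by rewrite /P sub0set imset0; apply/trivIsetP => ? ?; rewrite inE.
have [B /maxsetP[/andP[BA trivB] maxB] _] := maxset_exists P0.
exists B => //.
have covB : A \subset \bigcup_(u in cover (S @: B)) [set v | u \in S v].
  apply/subsetP => v vA; apply/bigcupP.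
  have [vB|vB] := boolP (v \in B).
    exists v; last by rewrite inE.
    by apply/bigcupP; exists (S v) => //; rewrite imset_f.
  have [/pred0P disj|/pred0Pn[u /andP[/= uS ucov]]] :=
    boolP [disjoint S v & cover (S @: B)]; last by exists u; rewrite ?inE.
  (* If [S v] missed the cover, [v] could be added to [B], against maximality. *)
  have : P (v |: B).
    rewrite /P subUset sub1set vA BA /= imsetU1.
    apply/trivIsetP => X Y.
    have dj X' : X' \in S @: B -> [disjoint S v & X'].
      move=> X'B; apply/pred0P => u /=; apply/negP => /andP[uv uX'].
      have /negP[] := negbT (disj u); rewrite /= uv.
      by apply/bigcupP; exists X'.
    rewrite !inE => /orP[/eqP->|XB] /orP[/eqP->|YB]; rewrite ?eqxx //.
    - by move=> _; exact: dj.
    - by move=> _; rewrite disjoint_sym; exact: dj.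
    - exact: (trivIsetP trivB).
  move/maxB => /(_ (subsetUr _ _)) eB.
  by move: vB; rewrite -eB !inE eqxx.
have bigcup_card (I : finType) (D : {set I}) (F : I -> {set T}) (b : nat) :
    (forall x, #|F x| <= b)%N -> (#|\bigcup_(x in D) F x| <= #|D| * b)%N.
  move=> Fb; apply: (@leq_trans (\sum_(x in D) #|F x|)).
    elim/big_rec2: _ => [|x m X _ le]; first by rewrite cards0.
    by apply: leq_trans (leq_card_setU _ _) _; rewrite leq_add2l.
  by rewrite -sum_nat_const; apply: leq_sum.
apply: leq_trans (subset_leq_card covB) _.
apply: leq_trans (bigcup_card _ _ _ _ Sr) _.
rewrite mulnC leq_mul2l; apply/orP; right.
move/eqP: trivB => <-; rewrite mulnC -sum_nat_const; apply: leq_sum => X.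
by case/imsetP => v _ ->.
Qed.

(** * Random colourings *)

(** This is (1 - 1/Q)^M <= 1/2 without denominators. The case [M = Q] suffices, since further
    factors are at most 1. *)
Lemma leq_expn_half (Q M : nat) : (0 < Q <= M)%N -> (2 * Q.-1 ^ M <= Q ^ M)%N.
Proof.
case: Q => // Q /= QM.
(* the first two terms of the binomial expansion of (Q + 1)^(Q + 1) *)
have base : (2 * Q ^ Q.+1 <= Q.+1 ^ Q.+1)%N.
  rewrite -[X in (_ <= X ^ _)%N]addn1 expnDn big_ord_recl big_ord_recl /=.
  rewrite !exp1n bin0 bin1 /bump /= subn0 !muln1 subSS subn0 !mul1n expnS; lia.
rewrite -(subnK QM) !expnD mulnCA leq_mul //.
by case: (M - _)%N => // m; rewrite leq_exp2r.
Qed.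

Section Colourings.
Variables (T : finType) (s : nat) (c : 'I_s).
Implicit Types (f : {ffun T -> 'I_s}) (S : {set T}) (F : {set {set T}}).

(** The bad event for the colour [c]; cardinalities divided by [s ^ #|T|] are probabilities for a
    uniform colouring. *)
Definition avoiders F : {set {ffun T -> 'I_s}} :=
  [set f : {ffun T -> 'I_s} | [forall S in F, ~~ (S \subset f @^-1: [set c])]].

(* Recolouring [S] with [c] keeps a colouring in [avoiders F], and it is
   undone by the old colours on [S]. *)
Lemma card_avoiders_monochromatic F S :
  (forall S', S' \in F -> [disjoint S & S']) ->
  (#|avoiders F| <=
   #|[set f : {ffun T -> 'I_s} in avoiders F | S \subset f @^-1: [set c]]| *
   s ^ #|S|)%N.
Proof.
move=> SF.
pose z f : {ffun T -> 'I_s} := [ffun u => if u \in S then c else f u].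
pose r f : {ffun T -> 'I_s} := [ffun u => if u \in S then f u else c].
have inj_zr : injective (fun f => (z f, r f)).
  move=> f g [/ffunP zfg /ffunP rfg]; apply/ffunP => u.
  by have := zfg u; have := rfg u; rewrite !ffunE; case: (u \in S).
rewrite -(card_imset (avoiders F) inj_zr).
have -> : (s ^ #|S| = #|[set g in pffun_on c (mem S) (predT : pred 'I_s)]|)%N.
  by rewrite cardsE card_pffun_on cardT size_enum_ord.
rewrite -cardsX; apply/subset_leq_card/subsetP.
move=> _ /imsetP[f fF ->]; rewrite !inE; apply/andP; split; last first.
  apply/pffun_onP; split => //.
  by apply/subsetP => u; rewrite !inE !ffunE; case: ifP => //; rewrite eqxx.
apply/andP; split; last by apply/subsetP => u uS; rewrite !inE ffunE uS.
apply/forall_inP => S' S'F; move: fF; rewrite inE => /forall_inP/(_ _ S'F).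
apply: contra.
move/subsetP => sub; apply/subsetP => u uS'; have := sub u uS'.
rewrite !inE ffunE; case: ifP => // uS.
by have /pred0P/(_ u) := SF _ S'F; rewrite /= uS uS'.
Qed.

(** Disjoint sets are coloured independently, and each gets colour [c] throughout with probability
    at least s^-q; hence the factor 1 - s^-q for each set of [F]. *)
Lemma card_avoiders (q : nat) F :
  trivIset F -> (forall S, S \in F -> (#|S| <= q)%N) ->
  (#|avoiders F| * (s ^ q) ^ #|F| <= (s ^ q).-1 ^ #|F| * s ^ #|T|)%N.
Proof.
have s_gt0 : (0 < s)%N by case: s c => [[]|].
elim: {F}#|F| {-2}F (erefl #|F|) => [|m IH] F cF trivF Fq.
  rewrite cF !expn0 muln1 mul1n -[X in (_ <= X ^ _)%N](card_ord s) -card_ffun.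
  exact: max_card.
have [S SF] : exists S, S \in F by apply/card_gt0P; rewrite cF.
have cF' : #|F :\ S| = m by apply/eqP; rewrite -eqSS -cF (cardsD1 S F) SF.
have {IH} := IH _ cF' (trivIsetS (subD1set _ _) trivF) _.
have sub : forall S0, S0 \in F :\ S -> (#|S0| <= q)%N.
  by move=> S0 /setD1P[_ /Fq].
move=> /(_ sub); rewrite cF cF'.
have dj S' : S' \in F :\ S -> [disjoint S & S'].
  by case/setD1P => S'S S'F; apply: (trivIsetP trivF); rewrite // eq_sym.
have := card_avoiders_monochromatic dj.
set A := avoiders (F :\ S); set Z := [set f : {ffun T -> 'I_s} in A | _] => AZ IH.
have avE : avoiders F = A :\: Z.
  apply/setP => f; rewrite !inE; apply/forall_inP/andP.
    move=> fF; split; last by apply/forall_inP => S' /setD1P[_]; exact: fF.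
    by rewrite negb_and fF ?orbT.
  case=> + /forall_inP fF' => /nandP[/forall_inP[//]|fS] S' S'F.
  by have [->//|S'S] := eqVneq S' S; apply: fF'; rewrite !inE S'S.
have cavE : (#|avoiders F| + #|Z| = #|A|)%N.
  have ZA : Z \subset A by apply/subsetP => f; rewrite inE => /andP[].
  by rewrite avE addnC -(cardsID Z A) (setIidPr ZA).
have {}AZ : (#|A| <= #|Z| * s ^ q)%N.
  by apply: leq_trans AZ _; rewrite leq_mul2l leq_pexp2l ?orbT ?Fq.
have : (0 < s ^ q)%N by rewrite expn_gt0 s_gt0.
move: (s ^ q)%N AZ IH => Q AZ IH Q_gt0.
(* Removing [Z], at least a 1/Q share of [A] by [AZ], leaves at most a 1 - 1/Q share. *)
have step : (#|avoiders F| * Q <= #|A| * Q.-1)%N by nia.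
rewrite !expnS mulnA (leq_trans (leq_mul step (leqnn _))) //.
by rewrite [(#|A| * _)%N]mulnC -!mulnA leq_mul2l IH orbT.
Qed.

Lemma card_avoiders_half (q : nat) F :
  trivIset F -> (forall S, S \in F -> (#|S| <= q)%N) -> (s ^ q <= #|F|)%N ->
  (2 * #|avoiders F| <= s ^ #|T|)%N.
Proof.
move=> trivF Fq sF; have s_gt0 : (0 < s)%N by case: s c => [[]|].
have Q_gt0 : (0 < s ^ q)%N by rewrite expn_gt0 s_gt0.
have QM_gt0 : (0 < (s ^ q) ^ #|F|)%N by rewrite expn_gt0 Q_gt0.
rewrite -(leq_pmul2r QM_gt0) -mulnA.
apply: leq_trans (leq_mul (leqnn 2) (card_avoiders trivF Fq)) _.
by rewrite mulnA mulnC leq_mul // leq_expn_half // Q_gt0.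
Qed.
End Colourings.

(** * Counting recovered message bits *)

(** Messages supported on [I] are determined by the bits of their codewords in [A], so 2^|I| <=
    2^|A|. *)
Lemma card_recovered (n k : nat) (C : {linear 'rV['F_2]_k -> 'rV['F_2]_n})
    (I : {set 'I_k}) (A : {set 'I_n}) :
  (forall i, i \in I -> recovers C i A) -> (#|I| <= #|A|)%N.
Proof.
move=> IA.
pose h (x : 'rV['F_2]_#|I|) : 'rV['F_2]_k := \sum_a x 0 a *: delta_mx 0 (enum_val a).
have hE x a : h x 0 (enum_val a) = x 0 a.
  rewrite summxE (bigD1 a) //= !mxE !eqxx mulr1 big1 ?addr0 // => b ba.
  by rewrite !mxE eqxx (inj_eq enum_val_inj) eq_sym (negPf ba) mulr0.
pose g x : 'rV['F_2]_#|A| := \row_u C (h x) 0 (enum_val u).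
have inj_g : injective g.
  move=> x y /rowP gxy; apply/rowP => a; rewrite -!hE.
  apply/eqP; rewrite -subr_eq0; apply/eqP.
  have := IA _ (enum_valP a) (h x - h y); rewrite !mxE; apply => u uA.
  have := gxy (enum_rank_in uA u); rewrite !mxE enum_rankK_in // => e.
  by rewrite linearB !mxE e subrr.
by have := leq_card g inj_g; rewrite !card_mx !mul1n card_Fp // leq_exp2l.
Qed.

(** Count triples of a colour [c], a colouring [f] and an index [i] such that the class of [c]
    contains a set of [F i]. Each pair of [c] and [i] occurs with at least half of the colourings;
    for each [f] the classes partition the coordinates, so together they recover at most [n]
    indices. *)
Lemma recovery_bound (n k q s : nat)
    (C : {linear 'rV['F_2]_k -> 'rV['F_2]_n}) (F : 'I_k -> {set {set 'I_n}}) :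
  (forall i, trivIset (F i)) ->
  (forall i S, S \in F i -> (#|S| <= q)%N /\ recovers C i S) ->
  (forall i, (s ^ q <= #|F i|)%N) ->
  (k * s <= 2 * n)%N.
Proof.
move=> trivF FP sF.
case: s sF => [|s] sF; first by rewrite muln0.
pose rec c (f : {ffun 'I_n -> 'I_s.+1}) := [set i | f \notin avoiders c (F i)].
have le_rec c f : (#|rec c f| <= #|f @^-1: [set c]|)%N.
  apply: (card_recovered (C := C)) => i.
  rewrite !inE negb_forall => /existsP[S]; rewrite negb_imply negbK => /andP[SF Sf].
  by have [_ Si] := FP _ _ SF => m m0; apply: Si => u /(subsetP Sf)/m0.
have sum_pre (f : {ffun 'I_n -> 'I_s.+1}) : (\sum_c #|f @^-1: [set c]| = n)%N.
  rewrite -[RHS]card_ord -sum1_card (partition_big f predT) //=.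
  by apply: eq_bigr => c _; rewrite sum1dep_card; apply: eq_card => u; rewrite !inE.
have half c : (k * s.+1 ^ n <= 2 * \sum_f #|rec c f|)%N.
  have -> : (\sum_f #|rec c f| = \sum_i #|~: avoiders c (F i)|)%N.
    under eq_bigr do rewrite -sum1dep_card big_mkcond.
    rewrite exchange_big /=; apply: eq_bigr => i _; rewrite -sum1_card [RHS]big_mkcond.
    by apply: eq_bigr => f _; rewrite in_setC.
  rewrite big_distrr /= -[X in (X * _ <= _)%N]card_ord -sum_nat_const.
  apply: leq_sum => i _.
  have := card_avoiders_half c (trivF i) (fun S SF => (FP i S SF).1) (sF i).
  have := cardsC (avoiders c (F i)); rewrite card_ffun !card_ord => <-.
  by rewrite !mul2n -!addnn leq_add2l leq_add2r.
have sn_gt0 : (0 < s.+1 ^ n)%N by rewrite expn_gt0.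
rewrite -(leq_pmul2r sn_gt0).
apply: (@leq_trans (\sum_(c < s.+1) 2 * \sum_f #|rec c f|)%N).
  rewrite mulnAC mulnC -[X in (X * _ <= _)%N](card_ord s.+1) -sum_nat_const.
  by apply: leq_sum => c _; exact: half.
rewrite -big_distrr /= exchange_big /= -mulnA leq_mul2l /=.
rewrite mulnC -[X in (X ^ _)%N](card_ord s.+1) -[X in (_ ^ X)%N](card_ord n).
rewrite -card_ffun -sum_nat_const; apply: leq_sum => f _.
by rewrite -[leqRHS](sum_pre f); apply: leq_sum.
Qed.

(** * The bound for a single code *)

(** Take [s] largest with [s ^ (2 ^ l)] at most the guaranteed number [M] of disjoint recovery sets;
    maximality then bounds [M], and with it [d], from above. *)
Lemma code_bound (n k d l : nat) (C : {linear 'rV['F_2]_k -> 'rV['F_2]_n}) :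
  is_code d C ->
  (forall i, exists2 j : 'I_k, j != i &
     exists a (c : circuit (n + a)),
       is_gadget C (CNOT i j) c /\ depth c = l) ->
  exists s, (k * s <= 2 * n)%N /\ (0 < d <= (2 * 4 ^ l * s) ^ (2 ^ l))%N.
Proof.
case=> injC [m0 Cm0 dm0] dmin gadgets.
have d_gt0 : (0 < d)%N.
  rewrite -dm0 card_gt0; apply: contraNneq Cm0 => /setP w0; apply/eqP/rowP => u.
  by have := w0 u; rewrite !inE mxE => /negbFE/eqP.
have q_gt0 : (0 < 2 ^ l)%N by rewrite expn_gt0.
(* This is d / 4^l rounded up; 4^l is the product of the bounds 2^l on backward and forward
   cones. *)
pose M := (d.-1 %/ 4 ^ l).+1.
have dM : (d <= 4 ^ l * M)%N.
  by rewrite -(prednK d_gt0) mulnC ltn_ceil // expn_gt0.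
have family i : exists F : {set {set 'I_n}}, [/\ trivIset F,
    forall S, S \in F -> (#|S| <= 2 ^ l)%N /\ recovers C i S & (M <= #|F|)%N].
  have [j _ [a [c [gadc dc]]]] := gadgets i.
  have [S [Srefl Sq Sr Srec]] := CNOT_gadget_recovers gadc.
  rewrite dc in Sq Sr.
  pose A := [set v | C (delta_mx 0 j) 0 v != 0].
  have [B [BA trivB] cB] := disjoint_subfamily A Srefl Sq Sr.
  exists (S @: B); split=> // [X /imsetP[v vB ->]|].
    by split=> //; apply: Srec; have := subsetP BA v vB; rewrite inE.
  have dA : (d <= #|A|)%N.
    apply: dmin; rewrite -(linear0 C) (inj_eq injC).
    apply/eqP => /matrixP/(_ 0 j)/eqP; rewrite !mxE !eqxx.
    by rewrite oner_eq0.
  move: cB; rewrite mulnA -expnMn => /(leq_trans dA) dF.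
  by rewrite /M ltn_divLR ?expn_gt0 // prednK // mulnC.
have exP : exists s, (s ^ (2 ^ l) <= M)%N by exists 1%N; rewrite exp1n.
have leP s : (s ^ (2 ^ l) <= M)%N -> (s <= M)%N.
  by apply: leq_trans; case: s => // s; rewrite -[leqLHS]expn1 leq_pexp2l.
have [s sM maxs] := ex_maxnP exP leP.
exists s; split.
  have [F FP] := fin_all_exists family.
  apply: (recovery_bound (C := C) (F := F) (q := (2 ^ l)%N)) => i;
    have [? ? ?] := FP i => //.
  exact: leq_trans sM _.
rewrite d_gt0 /=.
have s_gt0 : (0 < s)%N by apply: maxs; rewrite exp1n.
have /ltnW Ms : (M < s.+1 ^ (2 ^ l))%N.
  by rewrite ltnNge; apply/negP => /maxs; rewrite ltnn.
(* The factor 4^l is absorbed into its own power, and [s.+1 <= 2 * s] because [s] is positive. *)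
rewrite mulnAC mulnC expnMn (leq_trans dM) // leq_mul //.
  by case: (2 ^ l)%N q_gt0 => // q _; rewrite expnS leq_pmulr // !expn_gt0.
by rewrite (leq_trans Ms) // leq_exp2r //; lia.
Qed.

(** At depth zero the gadget is the identity, so injectivity of [C] would force [CNOT i j] to fix
    e_i, whose coordinate [j] it changes. This gives 1 < 2^l. *)
Lemma CNOT_depth_gt0 (n k d a : nat) (C : {linear 'rV['F_2]_k -> 'rV['F_2]_n})
    (i j : 'I_k) (c : circuit (n + a)) :
  is_code d C -> j != i -> is_gadget C (CNOT i j) c -> (0 < depth c)%N.
Proof.
case=> injC _ _ ji; case: c => // gadc.
have /= := gadc (delta_mx 0 i).
rewrite /gadget_map /run_circuit /= row_mxKl => /injC/matrixP/(_ 0 j)/eqP.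
rewrite !mxE !eqxx (negPf ji) /=.
by rewrite add0r mulr1 eq_sym oner_eq0.
Qed.

(* Asymptotic form *)
From mathcomp Require Import all_classical all_reals all_analysis.
Import numFieldNormedType.Exports.
Local Open Scope classical_set_scope.
Local Open Scope ring_scope.

(* The family is a sequence of codes C t, with parameters [n t, k t, d t]. *)
Theorem theorem1 (R : realType) (n k d : nat -> nat)
    (C : forall t, {linear 'rV['F_2]_(k t) -> 'rV['F_2]_(n t)})
    (l alpha : nat) :
  n @ \oo --> \oo ->
  (forall t, is_code (d t) (C t)) ->
  (* k d = omega(n) *)
  (fun t => (n t)%:R : R^o) =o_\oo (fun t => (k t * d t)%:R : R^o) ->
  (forall t (i : 'I_(k t)), exists2 j : 'I_(k t), j != i &
     exists (a : nat) (c : circuit (n t + a)),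
       [/\ (a <= alpha * n t)%N, is_gadget (C t) (CNOT i j) c & depth c = l]) ->
  exists q : R, [/\ 1 < q, q <= 2 ^+ l &
    (fun t => (k t)%:R : R^o)
      =O_\oo (fun t => (n t)%:R / (d t)%:R `^ q^-1 : R^o)].
Proof.
move=> _ codeC _ gadgets.
have code_gadgets t (i : 'I_(k t)) : exists2 j : 'I_(k t), j != i &
    exists a (c : circuit (n t + a)), is_gadget (C t) (CNOT i j) c /\ depth c = l.
  by have [j ji [a [c [_ gadc dc]]]] := gadgets t i; exists j => //; exists a, c.
have l_gt0 : (0 < l)%N.
  have [_ [m Cm0 _] _] := codeC 0%N.
  have [i _] : exists i, m 0 i != 0.
    by apply/rV0Pn; apply: contraNneq Cm0 => ->; rewrite linear0.
  have [j ji [a [c [gadc <-]]]] := code_gadgets 0%N i.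
  exact: CNOT_depth_gt0 (codeC 0%N) ji gadc.
exists (2 ^+ l); split=> //.
  by rewrite -natrX ltr1n -[ltnLHS](expn0 2) ltn_exp2l.
(* With q = 2^l, the bounds k s <= 2n and d^(1/q) <= 2 * 4^l * s combine to k d^(1/q) <= 2 * (2 *
   4^l) * n. *)
apply/eqO_exP; exists (2 * (2 * 4 ^ l))%:R; first by rewrite ltr0n !muln_gt0 expn_gt0.
near=> t; have [s [ks /andP[d_gt0 ds]]] := code_bound (codeC t) (code_gadgets t).
have D_gt0 : 0 < (d t)%:R `^ (2 ^+ l)^-1 :> R by apply: powR_gt0; rewrite ltr0n.
have Ds : (d t)%:R `^ (2 ^+ l)^-1 <= (2 * 4 ^ l * s)%:R :> R.
  have q_gt0 : 0 < (2 ^ l)%:R :> R by rewrite ltr0n expn_gt0.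
  have -> : (2 * 4 ^ l * s)%:R = ((2 * 4 ^ l * s) ^ (2 ^ l))%:R `^ (2 ^+ l)^-1 :> R.
    rewrite -[2 ^+ l]natrX natrX -powR_mulrn ?ler0n // -powRrM.
    by rewrite mulfV ?powRr1 ?ler0n ?lt0r_neq0.
  by rewrite ge0_ler_powR ?nnegrE ?invr_ge0 ?exprn_ge0 ?ler0n ?ler_nat.
rewrite normr_nat ger0_norm ?divr_ge0 ?ler0n ?(ltW D_gt0) // mulrA ler_pdivlMr //.
apply: le_trans (ler_wpM2l (ler0n _ _) Ds) _.
rewrite -!natrM ler_nat; move: ks; move: (4 ^ l)%N => K; nia.
Unshelve. all: by end_near.
Qed.
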